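(* Let $Q=[q_1,\dots,q_N]^T\in\mathbb{S}^N$ and let $O=QQ^*\in\mathbb{H}^{N\times N}$. Let $r\subseteq\{1,\dots,N\}$ be a nonempty set of indices, and for a vector $P\in\mathbb{H}^N$ let $P_r$ denote the sub-vector of $P$ with entries indexed by $r$. Then the right eigenvalues of $O$ are $N$ (with multiplicity $1$) and $0$ (with multiplicity $N-1$), and for every right eigenvector $R$ of $O$ associated to the eigenvalue $N$, setting $$s=\left(R_r^*R_r\right)^{-1}\left(R_r^*Q_r\right),$$ one has $Q=R\,s$. (That is, the algorithm which computes such an eigenvector $R$ of $O$, then computes $s$ from $R_r$ and $Q_r$, and returns $Rs$, recovers $Q$ exactly from $O$ and $Q_r$.)
   Context: $\mathbb{H}$ denotes the quaternions and $\mathbb{S}$ the set of quaternions of Euclidean norm $1$; $\mathbb{S}^N$ is the set of column vectors of length $N$ with entries in $\mathbb{S}$. $*$ denotes conjugate transposition. A right eigenvector of $O$ for a real eigenvalue $\lambda$ is a nonzero $V\in\mathbb{H}^N$ with $OV=V\lambda$; a hermitian quaternion matrix has real right eigenvalues and is diagonalisable in an orthonormal basis, and multiplicities refer to this diagonalisation. $Q$ represents the attitudes of $N$ sensors, $O$ is the matrix of relative attitudes $q_i\overline{q_j}$, and $Q_r$ is the vector of known (reference) attitudes. $Rs$ denotes right multiplication of each entry of $R$ by $s$. *)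

(* Defs.v *)
From HB Require Import structures.
From mathcomp Require Import all_boot all_order all_algebra.
From mathcomp Require Import reals ring lra.

Set Implicit Arguments.
Unset Strict Implicit.
Unset Printing Implicit Defensive.

Import Order.TTheory GRing.Theory Num.Theory.

Local Open Scope ring_scope.

(* [Quat a b c d] is a + b i + c j + d k. *)
Record quat (R : rcfType) := Quat { q0 : R; q1 : R; q2 : R; q3 : R }.

Section QuaternionRing.
Variable R : rcfType.
Implicit Types x y z : quat R.

Definition tuple_of_quat x := (q0 x, q1 x, q2 x, q3 x).
Definition quat_of_tuple (t : R * R * R * R) :=
  let: (a, b, c, d) := t in Quat a b c d.

Fact tuple_of_quatK : cancel tuple_of_quat quat_of_tuple.
Proof. by case. Qed.

HB.instance Definition _ := Choice.copy (quat R) (can_type tuple_of_quatK).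

Definition qadd x y :=
  Quat (q0 x + q0 y) (q1 x + q1 y) (q2 x + q2 y) (q3 x + q3 y).
Definition qopp x := Quat (- q0 x) (- q1 x) (- q2 x) (- q3 x).

Fact qaddA : associative qadd.
Proof. by move=> x y z; rewrite /qadd /=; congr Quat; ring. Qed.
Fact qaddC : commutative qadd.
Proof. by move=> x y; rewrite /qadd; congr Quat; ring. Qed.
Fact qadd0 : left_id (Quat 0 0 0 0) qadd.
Proof. by case=> a b c d; rewrite /qadd /=; congr Quat; ring. Qed.
Fact qaddN : left_inverse (Quat 0 0 0 0) qopp qadd.
Proof. by case=> a b c d; rewrite /qadd /=; congr Quat; ring. Qed.

HB.instance Definition _ :=
  GRing.isZmodule.Build (quat R) qaddA qaddC qadd0 qaddN.

(* i^2 = j^2 = k^2 = ijk = -1 *)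
Definition qmul x y :=
  Quat (q0 x * q0 y - q1 x * q1 y - q2 x * q2 y - q3 x * q3 y)
       (q0 x * q1 y + q1 x * q0 y + q2 x * q3 y - q3 x * q2 y)
       (q0 x * q2 y - q1 x * q3 y + q2 x * q0 y + q3 x * q1 y)
       (q0 x * q3 y + q1 x * q2 y - q2 x * q1 y + q3 x * q0 y).

Fact qmulA : associative qmul.
Proof. by move=> x y z; rewrite /qmul /=; congr Quat; ring. Qed.
Fact qmul1l : left_id (Quat 1 0 0 0) qmul.
Proof. by case=> a b c d; rewrite /qmul /=; congr Quat; ring. Qed.
Fact qmul1r : right_id (Quat 1 0 0 0) qmul.
Proof. by case=> a b c d; rewrite /qmul /=; congr Quat; ring. Qed.
Fact qmulDl : left_distributive qmul qadd.
Proof. by move=> x y z; rewrite /qmul /qadd /=; congr Quat; ring. Qed.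
Fact qmulDr : right_distributive qmul qadd.
Proof. by move=> x y z; rewrite /qmul /qadd /=; congr Quat; ring. Qed.
Fact qone_neq0 : Quat 1 0 0 0 != 0 :> quat R.
Proof. by apply/eqP => -[] /eqP; rewrite oner_eq0. Qed.

HB.instance Definition _ :=
  GRing.Zmodule_isNzRing.Build (quat R) qmulA qmul1l qmul1r qmulDl qmulDr
    qone_neq0.

Definition qconj x := Quat (q0 x) (- q1 x) (- q2 x) (- q3 x).
Definition qnorm2 x := q0 x ^+ 2 + q1 x ^+ 2 + q2 x ^+ 2 + q3 x ^+ 2.
Definition qnorm x := Num.sqrt (qnorm2 x).
Definition qreal (a : R) : quat R := Quat a 0 0 0.

(* The ring inverse [x^-1] on quaternions; its value at 0 is 0. *)
Definition qinv x := qreal (qnorm2 x)^-1 * qconj x.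

Fact qnorm2_eq0 x : (qnorm2 x == 0) = (x == 0).
Proof.
apply/eqP/eqP => [|->]; last by rewrite /qnorm2 /= !expr0n /= !addr0.
case: x => a b c d; rewrite /qnorm2 /= => H.
have sq0 t : t ^+ 2 <= 0 -> t = 0 :> R.
  by move=> ht; apply/eqP; rewrite -(sqrf_eq0 t) eq_le ht sqr_ge0.
move: (sqr_ge0 a) (sqr_ge0 b) (sqr_ge0 c) (sqr_ge0 d) => Ha Hb Hc Hd.
by congr Quat; apply: sq0; lra.
Qed.

Fact qmulVx : {in [pred x : quat R | x != 0], left_inverse 1 qinv *%R}.
Proof.
move=> x; rewrite inE -qnorm2_eq0 => hx.
rewrite /qinv; congr Quat; rewrite /= -?[RHS](mulVf hx) /qnorm2; ring.
Qed.
Fact qmulxV : {in [pred x : quat R | x != 0], right_inverse 1 qinv *%R}.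
Proof.
move=> x; rewrite inE -qnorm2_eq0 => hx.
rewrite /qinv; congr Quat; rewrite /= -?[RHS](mulVf hx) /qnorm2; ring.
Qed.
Fact qunitP x y : y * x = 1 /\ x * y = 1 -> [pred x : quat R | x != 0] x.
Proof.
move=> [h _]; apply/eqP => x0; move/eqP: h.
by rewrite x0 mulr0 eq_sym oner_eq0.
Qed.
Fact qinv_out : {in [predC [pred x : quat R | x != 0]], qinv =1 id}.
Proof.
move=> x; rewrite !inE negbK => /eqP ->.
by rewrite /qinv; congr Quat => /=; ring.
Qed.

HB.instance Definition _ :=
  GRing.NzRing_hasMulInverse.Build (quat R) qmulVx qmulxV qunitP qinv_out.

End QuaternionRing.

Definition adjmx (R : rcfType) m n (A : 'M[quat R]_(m, n)) : 'M[quat R]_(n, m) :=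
  (map_mx (@qconj R) A)^T.

(* [hdot U V] is the quaternion U^* V, the entry of a 1 x 1 matrix. *)
Definition hdot (R : rcfType) n (U V : 'cV[quat R]_n) : quat R :=
  (adjmx U *m V) 0 0.

(* [rscale V s] is V s; the library's [s *: V] multiplies on the left. *)
Definition rscale (R : rcfType) n (V : 'cV[quat R]_n) (s : quat R) :
  'cV[quat R]_n := map_mx (fun x => x * s) V.

Definition subvec (R : rcfType) n (r : {set 'I_n}) (P : 'cV[quat R]_n) :
  'cV[quat R]_#|r| := \col_k P (enum_val k) 0.

Definition right_eigenvector (R : rcfType) n (O : 'M[quat R]_n)
    (lam : quat R) (V : 'cV[quat R]_n) : Prop :=
  V <> 0 /\ O *m V = rscale V lam.

Definition right_eigenvalue (R : rcfType) n (O : 'M[quat R]_n)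
    (lam : quat R) : Prop :=
  exists V, right_eigenvector O lam V.

Definition orthonormal_basis (R : rcfType) n
    (V : 'I_n -> 'cV[quat R]_n) : Prop :=
  (forall i j, hdot (V i) (V j) = (i == j)%:R) /\
  (forall X, exists c : 'I_n -> quat R, X = \sum_i rscale (V i) (c i)).

Definition diagonalises (R : rcfType) n (O : 'M[quat R]_n)
    (V : 'I_n -> 'cV[quat R]_n) (d : 'I_n -> R) : Prop :=
  orthonormal_basis V /\ forall i, O *m V i = rscale (V i) (qreal (d i)).

(* [O] is diagonalisable in an orthonormal basis with real eigenvalues, and in
   any such diagonalisation [lam] occurs exactly [m] times. *)
Definition right_multiplicity (R : rcfType) n (O : 'M[quat R]_n)
    (lam : R) (m : nat) : Prop :=
  (exists V d, diagonalises O V d) /\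
  (forall V d, diagonalises O V d -> #|[set i | d i == lam]| = m).

(* Main.v *)
Require Import Defs.
From HB Require Import structures.
From mathcomp Require Import all_boot all_order all_algebra.
From mathcomp Require Import reals ring.
Import Order.TTheory GRing.Theory Num.Theory.
Local Open Scope ring_scope.

Set Implicit Arguments.
Unset Strict Implicit.
Unset Printing Implicit Defensive.

(** Since O V = Q (Q^* V) and Q^* Q = N, an eigenvector V either satisfies
    Q^* V = 0, with eigenvalue 0, or is a right multiple Q u of Q, with
    eigenvalue N; in the latter case s = u^-1.  In an orthonormal eigenbasis two
    distinct vectors cannot both be multiples of Q, and not all of them are
    killed by O, which yields the multiplicities without dimension theory.  An
    orthonormal eigenbasis is diag(Q) H, where H is the real Householder matrix
    exchanging e_0 and the unit vector (1, ..., 1) / sqrt N. *)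

(** * Real quaternions, conjugation and norms *)

Fact qreal_zmod_morphism (R : rcfType) : zmod_morphism (@qreal R).
Proof. by move=> a b; congr Quat; rewrite /= subr0. Qed.

Fact qreal_monoid_morphism (R : rcfType) : monoid_morphism (@qreal R).
Proof. by split=> // a b; congr Quat; rewrite /=; ring. Qed.

HB.instance Definition _ (R : rcfType) :=
  GRing.isZmodMorphism.Build R (quat R) (@qreal R) (@qreal_zmod_morphism R).
HB.instance Definition _ (R : rcfType) :=
  GRing.isMonoidMorphism.Build R (quat R) (@qreal R) (@qreal_monoid_morphism R).

Fact qconj_zmod_morphism (R : rcfType) : zmod_morphism (@qconj R).
Proof. by move=> x y; congr Quat; rewrite /= ?opprD. Qed.

HB.instance Definition _ (R : rcfType) :=
  GRing.isZmodMorphism.Build (quat R) (quat R) (@qconj R)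
    (@qconj_zmod_morphism R).

Lemma qreal_inj (R : rcfType) : injective (@qreal R).
Proof. by move=> a b []. Qed.

Lemma qreal_comm (R : rcfType) (a : R) (x : quat R) : qreal a * x = x * qreal a.
Proof. by case: x => x0 x1 x2 x3; congr Quat; rewrite /=; ring. Qed.

Lemma qconjM (R : rcfType) (x y : quat R) : qconj (x * y) = qconj y * qconj x.
Proof. by congr Quat; rewrite /=; ring. Qed.

Lemma qconj_real (R : rcfType) (a : R) : qconj (qreal a) = qreal a.
Proof. by congr Quat; rewrite /= oppr0. Qed.

Lemma qconj_mul (R : rcfType) (x : quat R) : qconj x * x = qreal (qnorm2 x).
Proof. by congr Quat; rewrite /= /qnorm2; ring. Qed.

Lemma qmul_conj (R : rcfType) (x : quat R) : x * qconj x = qreal (qnorm2 x).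
Proof. by congr Quat; rewrite /= /qnorm2; ring. Qed.

Lemma qnorm2_ge0 (R : rcfType) (x : quat R) : 0 <= qnorm2 x.
Proof. by rewrite !addr_ge0 ?sqr_ge0. Qed.

Lemma qnorm2_unit (R : rcfType) (x : quat R) : qnorm x = 1 -> qnorm2 x = 1.
Proof.
by move=> x1; rewrite -(sqr_sqrtr (qnorm2_ge0 x)) -/(qnorm x) x1 expr1n.
Qed.

Lemma qunitE (R : rcfType) (x : quat R) : (x \is a GRing.unit) = (x != 0).
Proof. by []. Qed.

Lemma qmul_eq0 (R : rcfType) (x y : quat R) : x * y = 0 -> x = 0 \/ y = 0.
Proof.
move=> xy0; have [->|x_neq0] := eqVneq x 0; first by left.
by right; apply: (@mulrI _ x); rewrite ?qunitE // xy0 mulr0.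
Qed.

(** * The product [U^* V] and scaling on the right *)

Lemma hdotE (R : rcfType) n (U V : 'cV[quat R]_n) :
  hdot U V = \sum_k qconj (U k 0) * V k 0.
Proof. by rewrite /hdot mxE; apply: eq_bigr => k _; rewrite !mxE. Qed.

Lemma hdot_rscaler (R : rcfType) n (U V : 'cV[quat R]_n) s :
  hdot U (rscale V s) = hdot U V * s.
Proof.
by rewrite !hdotE mulr_suml; apply: eq_bigr => k _; rewrite mxE mulrA.
Qed.

Lemma hdot0r (R : rcfType) n (U : 'cV[quat R]_n) : hdot U 0 = 0.
Proof. by rewrite /hdot mulmx0 mxE. Qed.

Lemma hdot_self (R : rcfType) n (U : 'cV[quat R]_n) :
  hdot U U = qreal (\sum_k qnorm2 (U k 0)).
Proof.
by rewrite hdotE rmorph_sum; apply: eq_bigr => k _; apply: qconj_mul.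
Qed.

Lemma rscaleA (R : rcfType) n (V : 'cV[quat R]_n) s t :
  rscale (rscale V s) t = rscale V (s * t).
Proof. by apply/matrixP => i j; rewrite !mxE mulrA. Qed.

Lemma rscale1 (R : rcfType) n (V : 'cV[quat R]_n) : rscale V 1 = V.
Proof. by apply/matrixP => i j; rewrite mxE mulr1. Qed.

Lemma rscale0 (R : rcfType) n (V : 'cV[quat R]_n) : rscale V 0 = 0.
Proof. by apply/matrixP => i j; rewrite !mxE mulr0. Qed.

Lemma rscale0l (R : rcfType) n s : rscale (0 : 'cV[quat R]_n) s = 0.
Proof. by apply/matrixP => i j; rewrite !mxE mul0r. Qed.

Lemma rscale_eq0 (R : rcfType) n (V : 'cV[quat R]_n) s :
  rscale V s = 0 -> s <> 0 -> V = 0.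
Proof.
move=> Vs0 /eqP s_neq0.
rewrite -[V]rscale1 -(divrr (s_neq0 : s \is a GRing.unit)) -rscaleA.
by rewrite Vs0 rscale0l.
Qed.

Lemma mulmx_rscale (R : rcfType) m n (A : 'M[quat R]_(m, n)) V s :
  A *m rscale V s = rscale (A *m V) s.
Proof.
apply/matrixP => i j; rewrite !mxE mulr_suml.
by apply: eq_bigr => k _; rewrite mxE mulrA.
Qed.

Lemma mul_outer (R : rcfType) n (Q V : 'cV[quat R]_n) :
  Q *m adjmx Q *m V = rscale Q (hdot Q V).
Proof.
by rewrite -mulmxA; apply/matrixP => i j; rewrite !mxE big_ord1 !ord1.
Qed.

Lemma subvec_rscale (R : rcfType) n (r : {set 'I_n}) (V : 'cV[quat R]_n) s :
  subvec r (rscale V s) = rscale (subvec r V) s.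
Proof. by apply/matrixP => i j; rewrite !mxE. Qed.

(** * Eigenvalues and eigenvectors of [Q Q^*] *)

Lemma hdot_unit_entries (R : rcfType) n (Q : 'cV[quat R]_n) :
  (forall i, qnorm (Q i 0) = 1) -> hdot Q Q = qreal n%:R.
Proof.
move=> Q1; rewrite hdot_self (eq_bigr (fun=> 1)) ?sumr_const ?card_ord //.
by move=> k _; apply: qnorm2_unit.
Qed.

Lemma qreal_natr_neq0 (R : rcfType) n : (0 < n)%N -> qreal n%:R <> 0 :> quat R.
Proof. by move=> n_gt0 [] /eqP; rewrite pnatr_eq0 eqn0Ngt n_gt0. Qed.

(** Put t = Q^* V. Applying Q^* to Q t = V lam gives N t = t lam; the real N is central, so a
    nonzero t can be cancelled on the left. If t = 0, then V lam = 0 with V nonzero. *)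
Lemma eigenvalue_outer (R : rcfType) n (Q V : 'cV[quat R]_n) lam :
    hdot Q Q = qreal n%:R -> right_eigenvector (Q *m adjmx Q) lam V ->
  (hdot Q V <> 0 /\ lam = qreal n%:R) \/ (hdot Q V = 0 /\ lam = 0).
Proof.
move=> QQ [V_neq0]; rewrite mul_outer => eqV.
have [t0|/eqP t_neq0] := eqVneq (hdot Q V) 0; [right|left]; split=> //.
  move: eqV; rewrite t0 rscale0 => /esym eqV.
  have [//|/eqP lam_neq0] := eqVneq lam 0.
  by case: V_neq0; apply: rscale_eq0 eqV lam_neq0.
have := congr1 (hdot Q) eqV; rewrite !hdot_rscaler QQ qreal_comm.
by move/mulrI => -> //; apply/eqP.
Qed.

(** The equation Q (Q^* V) = V N is divided on the right by N. *)
Lemma eigenvector_outer (R : rcfType) n (Q V : 'cV[quat R]_n) :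
    (0 < n)%N -> right_eigenvector (Q *m adjmx Q) (qreal n%:R) V ->
  exists2 u, u <> 0 & V = rscale Q u.
Proof.
move=> /(qreal_natr_neq0 (R := R)) /eqP n_neq0 [V_neq0].
rewrite mul_outer => eqV.
have defV : V = rscale Q (hdot Q V / qreal n%:R).
  by rewrite -rscaleA eqV rscaleA divrr ?rscale1.
exists (hdot Q V / qreal n%:R) => // u0.
by apply: V_neq0; rewrite defV u0 rscale0.
Qed.

Lemma orthonormal_neq0 (R : rcfType) n (V : 'I_n -> 'cV[quat R]_n) i :
  orthonormal_basis V -> V i <> 0.
Proof.
move=> [orthV _] V0; have /eqP := orthV i i.
by rewrite V0 hdot0r eqxx eq_sym oner_eq0.
Qed.

Lemma diagonalises_eigenvector (R : rcfType) n (O : 'M[quat R]_n) V d i :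
  diagonalises O V d -> right_eigenvector O (qreal (d i)) (V i).
Proof. by move=> [onV eqV]; split; [apply: orthonormal_neq0|apply: eqV]. Qed.

(** Describing all of [d] at once serves both multiplicities: the indices with value N form a
    singleton, those with value 0 its complement. *)
Lemma diagonalises_outer (R : rcfType) n (Q : 'cV[quat R]_n) V d :
    (0 < n)%N -> hdot Q Q = qreal n%:R -> diagonalises (Q *m adjmx Q) V d ->
  exists i0, forall i, d i = if i == i0 then n%:R else 0.
Proof.
move=> n_gt0 QQ diagV; have [[orthV spanV] eqV] := diagV.
have n_neq0 := qreal_natr_neq0 (R := R) n_gt0.
have d0N i : d i <> n%:R -> d i = 0.
  by case: (eigenvalue_outer QQ (diagonalises_eigenvector i diagV)) => -[_]
    /qreal_inj.
(* Otherwise O kills the whole basis, hence Q, although O Q = Q N is nonzero. *)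
have [i0 /eqP di0] : exists i0, d i0 == n%:R.
  apply/existsP; apply: contraT; rewrite negb_exists => /forallP dN.
  have OV0 i : Q *m adjmx Q *m V i = 0.
    by rewrite eqV d0N ?rscale0 //; apply/eqP/dN.
  have [c defQ] := spanV Q.
  have : Q *m adjmx Q *m Q = 0.
    rewrite {3}defQ mulmx_sumr big1 // => i _.
    by rewrite mulmx_rscale OV0 rscale0l.
  rewrite mul_outer QQ => /rscale_eq0 -/(_ n_neq0) Q0.
  by case: n_neq0; rewrite -QQ Q0 hdot0r.
exists i0 => i; have [->//|i_neq] := eqVneq i i0.
apply: d0N => di.
have [u u_neq0 defVi] : exists2 u, u <> 0 & V i = rscale Q u.
  apply: eigenvector_outer n_gt0 _; rewrite -di.
  by apply: diagonalises_eigenvector.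
have [v v_neq0 defVi0] : exists2 v, v <> 0 & V i0 = rscale Q v.
  apply: eigenvector_outer n_gt0 _; rewrite -di0.
  by apply: diagonalises_eigenvector.
(* Orthogonality reads (V_i^* Q) v = 0 with v nonzero, so V_i^* Q = 0. Since V_i = Q u, this makes
   V_i^* V_i zero instead of 1. *)
have := orthV i i0; rewrite (negPf i_neq) defVi0 hdot_rscaler => /qmul_eq0[|//].
move=> QiQ; have Qi0 : hdot (V i) (V i) = 0.
  by rewrite {2}defVi hdot_rscaler QiQ mul0r.
by move: (orthV i i) => /eqP; rewrite Qi0 eqxx eq_sym oner_eq0.
Qed.

(** * The real Householder matrix *)

Definition invsqrt (R : rcfType) n : R := (Num.sqrt n.+1%:R)^-1.

Lemma invsqrt_gt0 (R : rcfType) n : 0 < invsqrt R n.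
Proof. by rewrite invr_gt0 sqrtr_gt0 ltr0n. Qed.

Lemma invsqrt_sqr (R : rcfType) n : n.+1%:R * invsqrt R n ^+ 2 = 1.
Proof. by rewrite exprVn sqr_sqrtr ?ler0n // divff // pnatr_eq0. Qed.

(* The reflection w w^T / (1 + c) - 1 with w = e_0 + (c, ..., c); using the sum
   rather than the difference of the two unit vectors keeps the denominator
   nonzero when n = 0. *)
Definition householder (R : rcfType) n : 'M[R]_n.+1 :=
  let c := invsqrt R n in
  \matrix_(i, j)
    ((c + (i == 0)%:R) * (c + (j == 0)%:R) / (1 + c) - (i == j)%:R).

Lemma householder_sym (R : rcfType) n i j :
  householder R n i j = householder R n j i.
Proof. by rewrite !mxE [j == i]eq_sym [(_ + (j == 0)%:R) * _]mulrC. Qed.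

(** The entry w_0 = 1 + c cancels the denominator, leaving w_i minus the delta at 0. *)
Lemma householder0 (R : rcfType) n i : householder R n i 0 = invsqrt R n.
Proof.
have c_gt0 := invsqrt_gt0 R n.
have c1_neq0 : 1 + invsqrt R n != 0 by rewrite gt_eqF // addr_gt0.
by rewrite mxE eqxx [_ + true%:R]addrC mulfK // addrK.
Qed.

Lemma householder_orth (R : rcfType) n i j :
  \sum_k householder R n i k * householder R n j k = (i == j)%:R.
Proof.
have c_gt0 := invsqrt_gt0 R n; have c_sqr := invsqrt_sqr R n.
have c1_neq0 : 1 + invsqrt R n != 0 by rewrite gt_eqF // addr_gt0.
set c := invsqrt R n in c_gt0 c_sqr c1_neq0 *.
pose w (k : 'I_n.+1) : R := c + (k == 0)%:R.
have sum_delta (F : 'I_n.+1 -> R) l : \sum_k F k * (l == k)%:R = F l.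
  rewrite (bigD1 l) //= eqxx mulr1 big1 ?addr0 // => k.
  by rewrite eq_sym => /negPf ->; rewrite mulr0.
have sum_ww : \sum_k w k * w k = 2 * (1 + c).
  (* With d the delta at 0, (c + d)^2 = c^2 + (2c + d) d: the first term sums to (n+1) c^2 = 1, the
     second to 2c + 1. *)
  transitivity (\sum_(k < n.+1)
        (c ^+ 2 + (2 * c + (k == 0)%:R) * ((0 : 'I_n.+1) == k)%:R)).
    by apply: eq_bigr => k _; rewrite /w eq_sym; case: (_ == _) => /=; ring.
  rewrite big_split /= sumr_const card_ord -[_ ^+ 2 *+ _]mulr_natl c_sqr.
  by rewrite (sum_delta (fun k : 'I_n.+1 => 2 * c + (k == 0)%:R)) /=; ring.
(* After summation the quadratic term is 2 w_i w_j / (1 + c), which the two cross terms cancel; only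
   the product of deltas survives. *)
transitivity (\sum_k ((w i * w j / (1 + c) ^+ 2) * (w k * w k)
    + (- (w i * w k / (1 + c))) * (j == k)%:R
    + ((- (w j * w k / (1 + c))) * (i == k)%:R + (j == k)%:R * (i == k)%:R))).
  by apply: eq_bigr => k _; rewrite !mxE -/c -/(w _) -/(w _) -/(w _); field.
rewrite !big_split /= -mulr_sumr sum_ww.
rewrite (sum_delta (fun k => - (w i * w k / (1 + c)))).
rewrite (sum_delta (fun k => - (w j * w k / (1 + c)))).
by rewrite (sum_delta (fun k => (j == k)%:R)) eq_sym; field.
Qed.

(** Column 0 is constantly c, so c times the sum of column [j] is the inner product of columns [j]
    and 0. *)
Lemma householder_sum (R : rcfType) n j :
  \sum_i householder R n i j = (j == 0)%:R / invsqrt R n.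
Proof.
have c_neq0 : invsqrt R n != 0 by rewrite gt_eqF ?invsqrt_gt0.
apply: (mulIf c_neq0); rewrite divfK // -householder_orth mulr_suml.
apply: eq_bigr => k _.
by rewrite householder_sym [_ 0 k]householder_sym householder0.
Qed.

Lemma sum_qreal_sandwich (R : rcfType) (I : finType) (F G : I -> R)
    (x y : quat R) :
  \sum_k x * qreal (F k) * (qreal (G k) * y) = x * qreal (\sum_k F k * G k) * y.
Proof.
rewrite rmorph_sum mulr_sumr mulr_suml; apply: eq_bigr => k _.
by rewrite rmorphM !mulrA.
Qed.

(** * An orthonormal eigenbasis of [Q Q^*] *)

Definition outer_basis (R : rcfType) n (Q : 'cV[quat R]_n.+1) (j : 'I_n.+1) :
    'cV[quat R]_n.+1 :=
  \col_i (Q i 0 * qreal (householder R n i j)).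

Lemma outer_basisE (R : rcfType) n (Q : 'cV[quat R]_n.+1) i j :
  outer_basis Q j i 0 = Q i 0 * qreal (householder R n i j).
Proof. by rewrite mxE. Qed.

(** In each inner product the factors conj(q_k) q_k = 1 drop out and orthogonality of H remains. For
    spanning, the coordinates of [X] are its products with the basis vectors. *)
Lemma outer_basis_orthonormal (R : rcfType) n (Q : 'cV[quat R]_n.+1) :
  (forall i, qnorm (Q i 0) = 1) -> orthonormal_basis (outer_basis Q).
Proof.
move=> Q1; split=> [i j|X].
  rewrite hdotE -(rmorph_nat (@qreal R)) -householder_orth rmorph_sum.
  apply: eq_bigr => k _; rewrite !outer_basisE qconjM qconj_real -mulrA.
  rewrite [qconj _ * _]mulrA qconj_mul qnorm2_unit //.
  by rewrite mul1r -rmorphM !(householder_sym _ k).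
exists (fun k => hdot (outer_basis Q k) X).
apply/matrixP => i j; rewrite ord1 {j} summxE.
(* The inserted delta is then expanded as the inner product of rows [i] and [l] of H. *)
transitivity (\sum_l Q i 0 * qreal (i == l)%:R * (qconj (Q l 0) * X l 0)).
  rewrite (bigD1 i) //= eqxx mulr1 mulrA qmul_conj qnorm2_unit // mul1r.
  rewrite big1 ?addr0 // => l; rewrite eq_sym => /negPf ->.
  by rewrite rmorph0 mulr0 mul0r.
under [RHS]eq_bigr => k _ do rewrite mxE outer_basisE hdotE mulr_sumr.
rewrite exchange_big; apply: eq_bigr => l _ /=.
rewrite -householder_orth -sum_qreal_sandwich.
by apply: eq_bigr => k _; rewrite outer_basisE qconjM qconj_real !mulrA.
Qed.

Lemma outer_basis_diagonalises (R : rcfType) n (Q : 'cV[quat R]_n.+1) :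
    (forall i, qnorm (Q i 0) = 1) ->
  diagonalises (Q *m adjmx Q) (outer_basis Q)
    (fun j => if j == 0 then n.+1%:R else 0).
Proof.
move=> Q1; split=> [|j]; first exact: outer_basis_orthonormal.
(* Q^* times basis vector [j] is the sum of column [j] of H, which vanishes unless [j] is 0. *)
have -> : Q *m adjmx Q *m outer_basis Q j
        = rscale Q (qreal ((j == 0)%:R / invsqrt R n)).
  rewrite mul_outer hdotE -householder_sum rmorph_sum; congr (rscale Q _).
  apply: eq_bigr => k _.
  by rewrite outer_basisE mulrA qconj_mul qnorm2_unit // mul1r.
have [->|_] := eqVneq j 0; last by rewrite mul0r !rscale0.
apply/matrixP => i k; rewrite [k]ord1 mxE [RHS]mxE outer_basisE.
rewrite householder0 -mulrA -rmorphM; congr (_ * qreal _).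
have c_neq0 : invsqrt R n != 0 by rewrite gt_eqF ?invsqrt_gt0.
(* What remains is 1/c = c (n+1), from (n+1) c^2 = 1. *)
by apply: (mulIf c_neq0); rewrite divfK // mulrAC -expr2 mulrC invsqrt_sqr.
Qed.

Theorem mainTheorem3 (R : realType) (N : nat) (Q : 'cV[quat R]_N)
    (r : {set 'I_N})
    (Q_unit : forall i, qnorm (Q i 0) = 1)
    (r_nonempty : r != set0) :
  let O : 'M[quat R]_N := Q *m adjmx Q in
  [/\ forall lam : quat R,
        right_eigenvalue O lam <->
        lam = qreal N%:R \/ (lam = 0 /\ (1 < N)%N),
      right_multiplicity O N%:R 1,
      right_multiplicity O 0 (N - 1)
    & forall V : 'cV[quat R]_N, right_eigenvector O (qreal N%:R) V ->
        let s := (hdot (subvec r V) (subvec r V))^-1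
                 * hdot (subvec r V) (subvec r Q) in
        Q = rscale V s].
Proof.
(* A nonempty [r] excludes N = 0. *)
case: N => [|n] in Q r Q_unit r_nonempty *.
  by case/set0Pn: r_nonempty => -[].
move=> O; have QQ := hdot_unit_entries Q_unit.
have diagO := outer_basis_diagonalises Q_unit.
have dE V d : diagonalises O V d ->
    exists i0, forall i, d i = if i == i0 then n.+1%:R else 0.
  exact: diagonalises_outer.
split.
- move=> lam; split.
    move=> [V eigV]; case: (eigenvalue_outer QQ eigV) => [[_ ->]|[QV ->]].
      by left.
    right; split=> //.
    (* For N = 1, Q^* V = 0 says conj(q) v = 0 with q of norm 1; multiplying by q gives v = 0, so no
       eigenvector for 0 exists. *)
    case: n => [|//] in Q r V O QV eigV Q_unit {r_nonempty QQ diagO dE} *.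
    case: eigV => V_neq0 _; case: V_neq0.
    apply/matrixP => i j; rewrite !ord1 mxE.
    move: QV; rewrite hdotE big_ord1 => /(congr1 ( *%R (Q 0 0))).
    by rewrite mulrA qmul_conj qnorm2_unit // mul1r mulr0.
  case=> [->|[-> n_gt0]].
    by exists (outer_basis Q 0); apply: (diagonalises_eigenvector 0 diagO).
  (* When N > 1 the last index differs from 0, so its basis vector has eigenvalue 0. *)
  exists (outer_basis Q ord_max).
  have := diagonalises_eigenvector ord_max diagO.
  by rewrite [ord_max == 0]negbTE // -val_eqE /= -lt0n.
- split=> [|V d /dE[i0 di]]; first by do 2!eexists; apply: diagO.
  rewrite (_ : [set _ | _] = [set i0]) ?cards1 //.
  apply/setP => i; rewrite !inE di; case: (i == i0); first by rewrite eqxx.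
  by rewrite eq_sym pnatr_eq0.
- split=> [|V d /dE[i0 di]]; first by do 2!eexists; apply: diagO.
  rewrite (_ : [set _ | _] = ~: [set i0]) ?cardsC1 ?card_ord ?subn1 //.
  apply/setP => i; rewrite !inE di; case: (i == i0); last by rewrite eqxx.
  by rewrite pnatr_eq0.
move=> V /eigenvector_outer -/(_ isT)[u /eqP u_neq0 defV] s.
have defQ : Q = rscale V u^-1 by rewrite defV rscaleA divrr ?rscale1.
suff -> : s = u^-1 by [].
(* The inverse in [s] needs a nonzero argument. A sum of squared norms equal to 0 would make V_i = 0
   for some i in [r], hence Q_i = V_i u^-1 = 0, against norm 1. *)
have VV_neq0 : hdot (subvec r V) (subvec r V) != 0.
  rewrite hdot_self; apply/eqP => -[] /eqP; rewrite psumr_eq0; last first.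
    by move=> k _; apply: qnorm2_ge0.
  case/set0Pn: r_nonempty => i ri /allP /(_ (enum_rank_in ri i)).
  rewrite mem_index_enum => /(_ isT) /=.
  rewrite qnorm2_eq0 mxE enum_rankK_in // => /eqP Vi0.
  have := qnorm2_unit (Q_unit i); rewrite defQ mxE Vi0 mul0r => /eqP.
  by rewrite (_ : qnorm2 0 = 0) 1?eq_sym ?oner_eq0 //; apply/eqP;
     rewrite qnorm2_eq0.
(* Substituting Q = V u^-1 turns the second factor of [s] into (V_r^* V_r) u^-1. *)
by rewrite /s defQ subvec_rscale hdot_rscaler mulrA mulVr ?mul1r.
Qed.
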